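(* Let $K$ be a convex, open set in $\mathbb{R}^n$ and let $c\colon K\times K\to\mathbb{R}$. Suppose that $f\colon K\to\mathbb{R}$ is such that for all $x,y\in K$ and all $\lambda\in [0,1]$ there is $$\lambda f(x)+(1-\lambda)f(y)-f(\lambda x+(1-\lambda)y)\leq \lambda c(\lambda x+(1-\lambda)y, x)+(1-\lambda)c(\lambda x+(1-\lambda)y,y).$$ Suppose that $c$ is $L$-Lipschitz in the second variable and is such that for all $x,y\in K$ there is $|c(x,y)|\leq \Lambda\|x-y\|$ for some constant $\Lambda$. Then $f$ is locally Lipschitz in $K$.
   Context: The constants $L$ and $\Lambda$ are independent of the points of $K$: $|c(x,y)-c(x,z)|\le L\|y-z\|$ for all $x,y,z\in K$. *)

(* Defs.v *)
From HB Require Import structures.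
From mathcomp Require Import all_boot all_order all_algebra.
From mathcomp Require Import all_classical all_reals all_analysis.
Set Implicit Arguments.
Unset Strict Implicit.
Unset Printing Implicit Defensive.
Import Order.TTheory GRing.Theory Num.Theory.
Import numFieldNormedType.Exports.
Local Open Scope classical_set_scope.
Local Open Scope ring_scope.

(* The library norm on 'rV[R]_n is the sup norm; it induces the same topology
   (so [open] and [nbhs] are the library's), but Lipschitz constants are
   measured here with the Euclidean norm. *)
Definition enorm (R : realType) (n : nat) (x : 'rV[R]_n) : R :=
  Num.sqrt (\sum_(i < n) x ord0 i ^+ 2).

Definition lipschitz_with (R : realType) (n : nat) (M : R) (A : set 'rV[R]_n)
    (g : 'rV[R]_n -> R) : Prop :=
  forall y z, A y -> A z -> `|g y - g z| <= M * enorm (y - z).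

Definition locally_lipschitz (R : realType) (n : nat) (A : set 'rV[R]_n)
    (g : 'rV[R]_n -> R) : Prop :=
  forall x, A x ->
    exists2 U, nbhs x U & exists M : R, lipschitz_with M (A `&` U) g.

(* Main.v *)
Require Import Defs.
From HB Require Import structures.
From mathcomp Require Import all_boot all_order all_algebra.
From mathcomp Require Import all_classical all_reals all_analysis.
From mathcomp Require Import ring lra.
Import Order.TTheory GRing.Theory Num.Theory.
Import numFieldNormedType.Exports.
Local Open Scope classical_set_scope.
Local Open Scope ring_scope.

(** The hypothesis and the bound on [c] say that [g = - f] is convex up to an
    error [C t (1 - t) |x - y|], and the classical argument for convex functions
    survives this error: [g] is bounded above on a small cube (interpolate one
    coordinate at a time between opposite faces), hence bounded below by
    reflection through the centre, and prolonging the segment from [y] to [z] by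
    a fixed length [r] beyond [z] turns the oscillation of [g] into a Lipschitz
    bound.  There [t = |y - z| / (r + |y - z|)], so the error is at most
    [C |y - z|]. *)

(** The error is measured in the norm of [V]; for row vectors this is the sup norm, whose balls are
    cubes. *)
Definition nearly_convex {R : realType} {V : normedModType R} (C : R)
    (K : set V) (g : V -> R) : Prop :=
  forall (x y : V) (t : R), K x -> K y -> 0 <= t <= 1 ->
    g (t *: x + (1 - t) *: y)
    <= t * g x + (1 - t) * g y + C * (t * (1 - t) * `|x - y|).

(** As [x0] is the midpoint of [x] and its reflection [x'], near convexity gives
    [g x >= 2 * g x0 - g x' - C * r], and [g x' <= M]. *)
Lemma nearly_convex_bounded (R : realType) (V : normedModType R) (C : R)
    (K : set V) (g : V -> R) (x0 : V) (r M : R) :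
  0 <= C -> 0 < r -> nearly_convex C K g ->
  (forall x, `|x - x0| <= r -> K x) ->
  (forall x, `|x - x0| <= r -> g x <= M) ->
  exists B, forall x, `|x - x0| <= r -> `|g x| <= B.
Proof.
move=> C0 r0 gC rK gM.
exists (`|M| + 2 * `|g x0| + C * r) => x xr.
pose x' := x0 - (x - x0).
have x'r : `|x' - x0| <= r.
  by rewrite /x' addrAC subrr add0r normrN.
have := gC x x' 2^-1 (rK _ xr) (rK _ x'r).
have half : 1 - 2^-1 = 2^-1 :> R by lra.
have -> : 2^-1 *: x + (1 - 2^-1) *: x' = x0.
  by rewrite half -scalerDr /x' opprB addrCA [x + _]addrC subrK
    scalerDr -scalerDl -[X in X + _]half
    subrK scale1r.
have -> : x - x' = 2 *: (x - x0).
  by rewrite /x' scaler_nat mulr2n opprB addrCA.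
rewrite normrZ ger0_norm// half => /(_ ltac:(lra)) gx0.
have Cx : C * `|x - x0| <= C * r by rewrite ler_wpM2l.
have := gM _ xr; have := gM _ x'r.
have := ler_norm M; have := ler_norm (g x0); have := lerNnormlW (lexx `|g x0|).
have := normr_ge0 M; have := normr_ge0 (g x0).
rewrite ler_norml.
move=> *; apply/andP; split; nra.
Qed.

(** The doubled radius leaves room to prolong segments of the smaller ball by [r]. *)
Lemma nearly_convex_lipschitz (R : realType) (V : normedModType R) (C : R)
    (K : set V) (g : V -> R) (x0 : V) (r B : R) :
  0 <= C -> 0 < r -> nearly_convex C K g ->
  (forall x, `|x - x0| <= r + r -> K x) ->
  (forall x, `|x - x0| <= r + r -> `|g x| <= B) ->
  forall y z, `|y - x0| <= r -> `|z - x0| <= r ->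
    `|g y - g z| <= (2 * B / r + C) * `|y - z|.
Proof.
move=> C0 r0 gC rK gB.
suff H y z : `|y - x0| <= r -> `|z - x0| <= r ->
    g z - g y <= (2 * B / r + C) * `|y - z|.
  move=> y z yr zr; rewrite ler_norml; apply/andP; split.
    by rewrite lerNl opprB H.
  by rewrite distrC H.
move=> yr zr.
have [->|yz] := eqVneq y z; first by rewrite !subrr normr0 mulr0.
set d := `|y - z|; have d0 : 0 < d by rewrite normr_gt0 subr_eq0.
pose w := z + (r / d) *: (z - y).
have wr : `|w - x0| <= r + r.
  rewrite /w addrAC (le_trans (ler_normD _ _))// lerD//.
  by rewrite normrZ gtr0_norm ?divr_gt0// [`|z - y|]distrC -/d divfK// gt_eqF.
have yr2 : `|y - x0| <= r + r by lra.
have rd : 0 < r + d by lra.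
pose t := d / (r + d).
have t01 : 0 <= t <= 1.
  apply/andP; split; first by apply: divr_ge0; exact: ltW.
  by rewrite ler_pdivrMr// mul1r lerDr ltW.
have wy : w - y = ((r + d) / d) *: (z - y).
  by rewrite /w mulrDl divff ?gt_eqF// scalerDl scale1r addrC addrA
    [RHS]addrC [- y + z]addrC.
have := gC w y t (rK _ wr) (rK _ yr2) t01.
have -> : t *: w + (1 - t) *: y = z.
  rewrite scalerBl scale1r addrCA -scalerBr wy scalerA /t mulrA divfK ?gt_eqF//.
  by rewrite divff ?gt_eqF// scale1r addrC subrK.
rewrite wy normrZ [`|z - y|]distrC -/d gtr0_norm ?divr_gt0//.
rewrite divfK ?gt_eqF//.
(* Here [r + d] is the length of [w - y], and [t * (r + d) = d]. *)
have -> : t * (1 - t) * (r + d) = (1 - t) * d.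
  by rewrite /t mulrAC divfK ?gt_eqF// mulrC.
have tr : t <= d / r.
  by rewrite ler_pM2l// lef_pV2 ?posrE// lerDl ltW.
have /andP[t0 _] := t01.
have Ct : C * ((1 - t) * d) <= C * d.
  by rewrite ler_wpM2l// ler_piMl ?(ltW d0)// lerBlDr lerDl.
have := gB _ wr; have := gB _ yr2; rewrite !ler_norml => /andP[gy _] /andP[_ gw].
have tB : t * (g w - g y) <= d / r * (2 * B).
  have B0 : 0 <= 2 * B by have := le_trans (normr_ge0 _) (gB _ wr); lra.
  by apply: (@le_trans _ _ (t * (2 * B))); [rewrite ler_wpM2l//; lra|
    rewrite ler_wpM2r].
have -> : (2 * B / r + C) * d = d / r * (2 * B) + C * d by ring.
lra.
Qed.

Section row_vectors.
Context {R : realType} {n : nat}.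
Implicit Types x y : 'rV[R]_n.

Lemma row_norm_le x (r : R) :
  0 <= r -> (`|x| <= r) <-> (forall i, `|x ord0 i| <= r).
Proof.
move=> r0; split=> [xr i|xr].
  apply: le_trans xr.
  rewrite [leRHS]/Num.norm/= mx_normrE.
  exact: (le_bigmax _ (fun i : 'I_1 * 'I_n => `|x i.1 i.2|) (ord0, i)).
rewrite /Num.norm/= mx_normrE; apply/bigmax_leP; split=> // -[i j] _ /=.
by rewrite ord1.
Qed.

Lemma norm_le_enorm x : `|x| <= enorm x.
Proof.
apply/row_norm_le; first exact: sqrtr_ge0.
move=> i; rewrite -sqrtr_sqr ler_wsqrtr// (bigD1 i)//= lerDl.
by apply: sumr_ge0 => j _; exact: sqr_ge0.
Qed.

(** The sum of squares is at most [n] times the square of the sup norm; bounding [n] by its square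
    keeps the constant free of roots. *)
Lemma enorm_le_norm x : enorm x <= n%:R * `|x|.
Proof.
rewrite -[leRHS]ger0_norm ?mulr_ge0// -sqrtr_sqr ler_wsqrtr//.
apply: (@le_trans _ _ (\sum_(i < n) `|x| ^+ 2)).
  apply: ler_sum => i _; rewrite -[x ord0 i ^+ 2]real_normK ?num_real//.
  by rewrite lerXn2r ?nnegrE//; move: i; exact/row_norm_le.
rewrite sumr_const card_ord -[leLHS]mulr_natl exprMn.
apply: ler_wpM2r; first exact: sqr_ge0.
by rewrite -natrX ler_nat; case: (n) => // m; rewrite leq_pmulr.
Qed.

(** Induction on the number of free coordinates: each point lies on an axis-parallel segment between
    opposite faces of the cube, where one coordinate fewer is free. *)
Lemma nearly_convex_bounded_above (C : R) (K : set 'rV[R]_n)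
    (g : 'rV[R]_n -> R) (x0 : 'rV[R]_n) (r : R) :
  0 <= C -> 0 < r -> nearly_convex C K g ->
  (forall x, `|x - x0| <= r -> K x) ->
  exists M, forall x, `|x - x0| <= r -> g x <= M.
Proof.
move=> C0 r0 gC rK.
(* Only the first [k] coordinates of [x] vary; the others are those of [v]. *)
suff H k v : `|v - x0| <= r -> exists M, forall x, `|x - x0| <= r ->
    (forall i : 'I_n, (k <= i)%N -> x ord0 i = v ord0 i) -> g x <= M.
  have [|M gM] := H n x0; first by rewrite subrr normr0 ltW.
  by exists M => x xr; apply: gM => // i; rewrite leqNgt ltn_ord.
elim: k v => [|k IHk] v vr.
  by exists (g v) => x _ xv; rewrite (_ : x = v)//; apply/rowP => i; exact: xv.
(* Past [n] there is no further coordinate to free. *)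
have [nk|kn] := leqP n k.
  have [M gM] := IHk v vr; exists M => x xr _; apply: gM => // i ki.
  by have := leq_trans nk ki; rewrite leqNgt ltn_ord.
pose j := Ordinal kn.
pose move_to x s := \row_(i < n) (if i == j then x0 ord0 j + s else x ord0 i).
have move_to_cube x s : `|x - x0| <= r -> `|s| <= r -> `|move_to x s - x0| <= r.
  move=> /row_norm_le-/(_ (ltW r0)) xr sr; apply/row_norm_le; first exact: ltW.
  move=> i; rewrite !mxE; have [->|_] := eqVneq i j; last first.
    by have := xr i; rewrite !mxE.
  by rewrite addrC addKr.
have rr : `|r| <= r by rewrite gtr0_norm.
have Nrr : `|- r| <= r by rewrite normrN.
have [M1 gM1] := IHk _ (move_to_cube _ _ vr rr).
have [M2 gM2] := IHk _ (move_to_cube _ _ vr Nrr).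
(* [M1] and [M2] bound [g] on the two faces, which are at most [r + r] apart. *)
exists (Num.max M1 M2 + C * (r + r)) => x xr xv.
have xpr := move_to_cube _ _ xr rr; have xmr := move_to_cube _ _ xr Nrr.
set xp := move_to x r in xpr *; set xm := move_to x (- r) in xmr *.
have agree s (i : 'I_n) : (k <= i)%N -> move_to x s ord0 i = move_to v s ord0 i.
  move=> ki; rewrite !mxE; case: eqVneq => // ij; apply: xv.
  by rewrite ltn_neqAle ki andbT; apply: contra ij => /eqP ki';
    apply/eqP/val_inj.
have gxp : g xp <= Num.max M1 M2.
  by rewrite le_max gM1//; exact: agree.
have gxm : g xm <= Num.max M1 M2.
  by rewrite le_max gM2 ?orbT//; exact: agree.
(* The weight that recovers coordinate [j] of [x] from its face values [x0 ord0 j + r] and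
   [x0 ord0 j - r]. *)
pose t := (x ord0 j - x0 ord0 j + r) / (r + r).
have rr0 : 0 < r + r by lra.
have /andP[t0 t1] : 0 <= t <= 1.
  have /row_norm_le-/(_ (ltW r0) j) := xr; rewrite !mxE ler_norml => /andP[? ?].
  apply/andP; split; first by apply: divr_ge0; lra.
  by rewrite ler_pdivrMr//; lra.
have -> : x = t *: xp + (1 - t) *: xm.
  apply/rowP => i; rewrite !mxE; have [->|_] := eqVneq i j; last by ring.
  by rewrite /t; field; rewrite gt_eqF.
have pm : `|xp - xm| <= r + r.
  rewrite -(subrKA x0) (le_trans (ler_normD _ _))// lerD//.
  by rewrite distrC.
have t10 : 0 <= 1 - t by lra.
apply: le_trans (gC _ _ t (rK _ xpr) (rK _ xmr) _) _; first by rewrite t0.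
rewrite lerD//.
  apply: (@le_trans _ _ (t * Num.max M1 M2 + (1 - t) * Num.max M1 M2)).
    by rewrite lerD// ler_wpM2l.
  by rewrite -mulrDl addrC subrK mul1r.
rewrite ler_wpM2l//; apply: le_trans pm.
by rewrite ler_piMl// mulr_ile1//; lra.
Qed.

End row_vectors.


(* c and f are total functions, constrained and used only at points of K. *)
Theorem theorem6p2 (R : realType) (n : nat) (K : set 'rV[R]_n)
    (c : 'rV[R]_n -> 'rV[R]_n -> R) (f : 'rV[R]_n -> R) (L Lambda : R)
    (K_convex : convex_set (K : set (convex_lmodType 'rV[R]_n)))
    (K_open : open K)
    (f_c : forall (x y : 'rV[R]_n) (lambda : R), K x -> K y ->
      0 <= lambda <= 1 ->
      lambda * f x + (1 - lambda) * f y - f (lambda *: x + (1 - lambda) *: y)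
      <= lambda * c (lambda *: x + (1 - lambda) *: y) x
         + (1 - lambda) * c (lambda *: x + (1 - lambda) *: y) y)
    (c_lipschitz : forall x : 'rV[R]_n, K x -> lipschitz_with L K (c x))
    (c_bound : forall x y : 'rV[R]_n, K x -> K y ->
      `|c x y| <= Lambda * enorm (x - y)) :
  locally_lipschitz K f.
Proof.
(* Each of the two terms in [c] contributes one half of [C]; [n%:R] converts the Euclidean norm to
   the sup norm, and [Lambda] has no prescribed sign. *)
pose C := 2 * (`|Lambda| * n%:R).
have C0 : 0 <= C by rewrite !mulr_ge0.
have gC : nearly_convex C K (fun x => - f x).
  move=> x y t Kx Ky t01; have /andP[t0 t1] := t01.
  have t10 : 0 <= 1 - t by lra.
  set m := t *: x + (1 - t) *: y.
  have Km : K m.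
    have := K_convex x y (Itv01 t0 t1); rewrite !inE; exact.
  have mx : m - x = (1 - t) *: (y - x).
    by apply/rowP => i; rewrite !mxE; ring.
  have my : m - y = t *: (x - y).
    by apply/rowP => i; rewrite !mxE; ring.
  have cb z : K z -> c m z <= `|Lambda| * n%:R * `|m - z|.
    move=> Kz; apply: le_trans (ler_norm _) _.
    apply: le_trans (c_bound _ _ Km Kz) _.
    apply: (@le_trans _ _ (`|Lambda| * enorm (m - z))).
      by rewrite ler_wpM2r ?sqrtr_ge0// ler_norm.
    by rewrite -mulrA ler_wpM2l// enorm_le_norm.
  have := ler_wpM2l t0 (cb x Kx); have := ler_wpM2l t10 (cb y Ky).
  have := f_c x y t Kx Ky t01; rewrite -/m.
  rewrite mx my !normrZ [`|y - x|]distrC (ger0_norm t0) (ger0_norm t10) /C.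
  move=> fm cy cx.
  lra.
move=> x Kx.
have /nbhs_closedballP[r] := open_nbhs_nbhs (conj K_open Kx).
rewrite closed_ballE// /closed_ball_ => rK.
have {}rK y : `|y - x| <= r%:num -> K y by rewrite distrC => /rK.
have [M gM] := nearly_convex_bounded_above _ _ _ _ _ C0 (gt0 r) gC rK.
have [B gB] := nearly_convex_bounded _ _ _ _ _ _ _ _ C0 (gt0 r) gC rK gM.
(* Halving the radius makes the bound [B] valid on the ball of radius [s + s]. *)
pose s := r%:num / 2.
have s0 : 0 < s by rewrite divr_gt0.
have ss : s + s = r%:num by rewrite -splitr.
rewrite -ss in rK gB.
exists (closed_ball x s).
  by apply/nbhs_closedballP; exists (PosNum s0).
(* A nonnegative constant allows the sup norm to be replaced by the larger Euclidean norm. *)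
exists `|2 * B / s + C| => y z [_ +] [_ +].
rewrite closed_ballE// /closed_ball_/= ![`|x - _|]distrC => ys zs.
have := nearly_convex_lipschitz _ _ _ _ _ _ _ _ C0 s0 gC rK gB _ _ ys zs.
rewrite -opprD normrN => /le_trans; apply.
apply: (@le_trans _ _ (`|2 * B / s + C| * `|y - z|)).
  by rewrite ler_wpM2r// ler_norm.
by rewrite ler_wpM2l// norm_le_enorm.
Qed.
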